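(* For every integer $k\ge 2$, the natural LP for weighted $k$-matroid intersection has integrality gap at most $k-1+\frac1k$. That is: for every finite set $E$, all matroids $M_1,\ldots,M_k$ on the common ground set $E$, and every weight vector $w\in\mathbb{R}^E$, $$\max\Bigl\{w\cdot x : x\in \bigcap_{i=1}^k P(M_i)\Bigr\}\ \le\ \Bigl(k-1+\frac1k\Bigr)\cdot \max\Bigl\{\sum_{e\in I}w_e : I\subseteq E,\ I \text{ is independent in } M_i \text{ for every } i=1,\ldots,k\Bigr\}.$$
   Context: For a matroid $M$ on a finite ground set $E$ with rank function $r_M$, its independent set polytope is $$P(M)=\operatorname{conv}\{\mathbf{1}_I: I \text{ independent in } M\}=\{y\in\mathbb{R}_{\ge0}^E:\ \textstyle\sum_{e\in S}y_e\le r_M(S)\ \text{for every } S\subseteq E\},$$ where $\mathbf{1}_I\in\{0,1\}^E$ is the incidence vector of $I$. The weighted $k$-matroid intersection problem asks for a maximum-weight set independent in all of $M_1,\ldots,M_k$; its natural LP relaxation maximizes $w\cdot x$ over $\bigcap_{i=1}^kP(M_i)$. The integrality gap of the LP is the worst-case ratio (over all instances) between the LP optimum and the maximum weight of a common independent set. *)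

(* Defs.v *)
From mathcomp Require Import all_boot all_order all_algebra.
From mathcomp Require Import boolp classical_sets reals.

Set Implicit Arguments.
Unset Strict Implicit.
Unset Printing Implicit Defensive.

Import Order.TTheory GRing.Theory Num.Theory.

Local Open Scope classical_set_scope.
Local Open Scope ring_scope.

Record matroid (E : finType) := Matroid {
  indep : pred {set E};
  indep0 : indep finset.set0;
  indepS : forall I J : {set E}, I \subset J -> indep J -> indep I;
  indep_aug : forall I J : {set E}, indep I -> indep J -> (#|I| < #|J|)%N ->
    exists2 e, e \in J :\: I & indep (e |: I)
}.

Definition incidence (R : realType) (E : finType) (I : {set E}) :
  E -> R := fun e => (e \in I)%:R.

(* There are finitely many generators, so one coefficient per independent set
   describes every convex combination. *)
Definition indep_polytope (R : realType) (E : finType) (M : matroid E) :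
  set (E -> R) :=
  [set x | exists c : {set E} -> R,
    [/\ forall I, indep M I -> 0 <= c I,
        \sum_(I | indep M I) c I = 1 &
        forall e, x e = \sum_(I | indep M I) c I * incidence R I e]].

Definition lp_values (R : realType) (k : nat) (E : finType)
  (M : 'I_k -> matroid E) (w : E -> R) : set R :=
  [set \sum_e w e * x e | x in \bigcap_i indep_polytope (M i)].

Definition common_indep_weights (R : realType) (k : nat) (E : finType)
  (M : 'I_k -> matroid E) (w : E -> R) : set R :=
  [set \sum_(e in I) w e | I in [set I : {set E} | forall i, indep (M i) I]].

Definition is_maximum (R : realType) (A : set R) (m : R) : Prop :=
  A m /\ ubound A m.

(* Main.v *)
Require Import Defs.
From mathcomp Require Import boolp classical_sets.
From mathcomp Require Import all_boot all_order all_algebra.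
From mathcomp Require Import reals lra ring zify.

(** The inequality is proved by a local ratio argument in which elements are
    retired one at a time and put back in the reverse order.

    Relax each P(M_i) to the polytope of its rank inequalities.  At every stage
    there is a set A of active elements and one point y_i of the i-th rank
    polytope for each i.  The y_i agree on A, with common value x, and are
    unrelated on the complement T of A, where the i-th point is rewarded by a
    weight u_i of its own.  To retire an active element e, let c_i be the loss
    in the u_i-optimum of M_i inside T when e is forced in, let
    g = max (0, w_e - sum_i c_i), and give e the weight u_i(e) = c_i + g.  Then
    - the u_i-optimum of every M_i grows by exactly g ([best_push]);
    - the objective at (y_i)_i changes by x_e (sum_i c_i + k g - w_e), which is
      at least (k - 1) g x_e;
    - a common independent set for the smaller active set gives one for A that
      is better by g, either unchanged or with e added ([residual_push], which
      rests on the symmetric exchange property).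

    The crux is that e can be chosen with x_e >= 1/k.  Move (y_i)_i to an
    extreme point without lowering the objective.  By uncrossing, the tight rank
    inequalities of y_i amount to at most y_i(E) equations
    ([tight_sets_spanned]), so there are at most k x(A) + sum_i y_i(T) equations
    in all.  If every x_e were below 1/k and x were nonzero, this would be less
    than the number of nonzero coordinates, and a direction preserving all tight
    constraints would exist ([extremal_large_coordinate]).

    When x vanishes on A the y_i are independent of each other, so the objective
    is at most the sum of the k matroid optima ([weight_le_indep]), that is k G
    for G the sum of all gains.  The steps raised the objective by at least
    (k - 1) G / k, so it started at no more than (k - 1 + 1/k) G, while putting
    elements back produces a common independent set of weight at least G.
    [local_ratio] is this argument as an induction on A.

    The maximum of the program over the convex hulls exists because every
    feasible point is dominated by an extreme point and there are finitely many
    of those ([maximum_attained]). *)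

Set Implicit Arguments.
Unset Strict Implicit.
Unset Printing Implicit Defensive.

Import Order.TTheory GRing.Theory Num.Theory.

Local Open Scope ring_scope.

(** * Matroid rank and exchange *)

Section Matroid.
Variables (E : finType) (M : matroid E).
Implicit Types (I J K S : {set E}) (e : E).

Lemma indep_extend I J : indep M I -> indep M J ->
  exists K, [/\ I \subset K, K \subset I :|: J, indep M K & (#|J| <= #|K|)%N].
Proof.
move=> + iJ; have [n] := ubnP (#|J| - #|I|)%N.
elim: n I => // n IHn I leIJ iI.
have [leJI|ltIJ] := leqP #|J| #|I|.
  by exists I; split; rewrite ?subsetUl.
have [e /setDP[eJ eI] ieI] := indep_aug iI iJ ltIJ.
have [|K [sK sKU iK leJK]] := IHn (e |: I) _ ieI.
  by rewrite cardsU1 eI add1n; lia.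
exists K; split=> //; first exact: subset_trans (subsetUr _ _) sK.
apply: subset_trans sKU _; rewrite -setUA subUset subxx andbT.
by rewrite sub1set !inE eJ orbT.
Qed.

Definition rank S : nat := \max_(I : {set E} | (I \subset S) && indep M I) #|I|.

Lemma leq_card_rank I S : I \subset S -> indep M I -> (#|I| <= rank S)%N.
Proof. by move=> sIS iI; apply: (@leq_bigmax_cond _ _ (fun I => #|I|)); rewrite sIS. Qed.

Lemma rank_witness S : exists I, [/\ I \subset S, indep M I & #|I| = rank S].
Proof.
have [|I /andP[sI iI] eqI] := @eq_bigmax_cond _
    [pred I : {set E} | (I \subset S) && indep M I] (fun I => #|I|).
  by apply/card_gt0P; exists finset.set0; rewrite inE sub0set indep0.
by exists I; split=> //; rewrite /rank eqI.
Qed.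

Lemma extend_to_basis I S : I \subset S -> indep M I ->
  exists K, [/\ I \subset K, K \subset S, indep M K & #|K| = rank S].
Proof.
move=> sIS iI; have [B [sB iB cB]] := rank_witness S.
have [K [sIK sK iK leBK]] := indep_extend iI iB.
have sKS : K \subset S by apply: subset_trans sK _; rewrite subUset sIS.
by exists K; split=> //; apply/eqP; rewrite eqn_leq leq_card_rank // -cB.
Qed.

(** Grow a basis of the intersection to a basis of the union and count its
    traces on both sets. *)
Lemma rank_submod S S' :
  (rank (S :|: S') + rank (S :&: S') <= rank S + rank S')%N.
Proof.
have [I [sI iI <-]] := rank_witness (S :&: S').
have sIU : I \subset S :|: S'.
  by apply: subset_trans sI _; rewrite subIset ?subsetUl.
have [K [sIK sK iK <-]] := extend_to_basis sIU iI.
have leS U : (#|K :&: U| <= rank U)%N.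
  by apply: leq_card_rank; [exact: subsetIr | apply: indepS iK; exact: subsetIl].
apply: leq_trans (leq_add (leS S) (leS S')).
rewrite -(cardsUI (K :&: S)) -setIUr (setIidPl sK) leq_add2l subset_leq_card //.
by rewrite setIACA setIid subsetI sIK.
Qed.

Lemma rank1 e : (rank [set e] <= 1)%N.
Proof.
have [I [sI _ <-]] := rank_witness [set e].
by rewrite -(cards1 e) subset_leq_card.
Qed.

Lemma rank1_indep e : (0 < rank [set e])%N -> indep M [set e].
Proof.
have [I [sI iI <-]] := rank_witness [set e].
by move: sI; rewrite subset1 => /orP[/eqP<-//|/eqP->]; rewrite cards0.
Qed.

(** The candidates for t form C, which together with e is the circuit of
    Y + e.  Some element of C must augment X - e: otherwise an independent set
    of size |X| extending C would have to contain e, although C + e is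
    dependent. *)
Lemma symmetric_exchange X Y e : indep M X -> indep M Y -> e \in X ->
  ~~ indep M (e |: Y) ->
  exists t, [/\ t \in Y, t \notin X, indep M (t |: X :\ e)
    & indep M (e |: Y :\ t)].
Proof.
move=> iX iY eX dY.
have eY : e \notin Y by apply: contra dY => eY; rewrite (setUidPr _) ?sub1set.
pose C := [set t in Y | indep M (e |: Y :\ t)].
have sCY : C \subset Y by apply/subsetP=> t; rewrite inE => /andP[].
have iC : indep M C by apply: indepS iY.
have dC : ~~ indep M (e |: C).
  apply/negP=> iC'; have [K [sCK sK iK leYK]] := indep_extend iC' iY.
  have sKY : K \subset e |: Y by rewrite (subset_trans sK) // -setUA (setUidPr sCY).
  have [KeY|] := eqVneq K (e |: Y); first by rewrite -KeY iK in dY.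
  move=> neK; have /properP[_ [t teY tK]] : K \proper e |: Y.
    by rewrite properEneq neK.
  have eK : e \in K by rewrite (subsetP sCK) // !inE eqxx.
  have tY : t \in Y.
    by move: teY; rewrite !inE => /orP[/eqP te|//]; rewrite te eK in tK.
  have KE : K = e |: Y :\ t.
    apply/eqP; rewrite eqEcard; apply/andP; split.
      apply/subsetP=> z zK; have := subsetP sKY z zK; rewrite !inE.
      case: (z =P t) => [zt|_]; first by rewrite -zt zK in tK.
      by [].
    rewrite cardsU1 !inE (negPf eY) andbF add1n.
    by rewrite (cardsD1 t Y) tY add1n in leYK.
  by case/negP: tK; rewrite (subsetP sCK) // !inE tY -KE iK orbT.
have [K [sCK sK iK leXK]] := indep_extend iC iX.
have eK : e \notin K.
  apply: contra dC => eK; apply: indepS iK.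
  by rewrite subUset sub1set eK.
have iXe : indep M (X :\ e) by apply: indepS iX; exact: subD1set.
have ltK : (#|X :\ e| < #|K|)%N.
  by apply: leq_trans leXK; rewrite (cardsD1 e X) eX.
have [t /setDP[tK tX] it] := indep_aug iXe iK ltK.
have te : t != e by apply: contraNneq eK => <-.
have tnX : t \notin X by move: tX; rewrite !inE te.
have : t \in C by have := subsetP sK t tK; rewrite in_setU (negPf tnX) orbF.
by rewrite inE => /andP[tY iYt]; exists t.
Qed.

End Matroid.

(** * Extreme points of linear programs *)

Section Programs.
Variables (R : realType) (V J : finType).

(** Additivity and homogeneity in one identity, in the form in which a row is
    evaluated when moving from z in direction d. *)
Definition is_linear (f : (V -> R) -> R) : Prop :=
  forall z d t, f (fun v => z v + t * d v) = f z + t * f d.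

Lemma is_linear0 f : is_linear f -> f (fun=> 0) = 0.
Proof.
move=> fL; have := fL (fun=> 0) (fun=> 0) 1.
by rewrite (_ : (fun _ => _) = fun=> 0); [lra | apply/funext => v; lra].
Qed.

Lemma is_linearZ f t d : is_linear f -> f (fun v => t * d v) = t * f d.
Proof.
move=> fL; rewrite -[RHS]add0r -(is_linear0 fL) -fL.
by congr f; apply/funext => v; rewrite add0r.
Qed.

Lemma is_linear_sum f n (a : 'I_n -> R) (g : 'I_n -> V -> R) : is_linear f ->
  f (fun v => \sum_(i < n) a i * g i v) = \sum_(i < n) a i * f (g i).
Proof.
move=> fL; elim: n a g => [|n IHn] a g.
  rewrite big_ord0 -[RHS](is_linear0 fL); congr f.
  by apply/funext => v; rewrite big_ord0.
rewrite big_ord_recr /= -IHn -fL; congr f.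
by apply/funext => v; rewrite big_ord_recr.
Qed.

(** A homogeneous system with fewer equations than unknowns; the unknowns are
    the coordinates in B, all others being set to zero. *)
Lemma nonzero_solution (I : eqType) (B : {set V}) (s : seq I)
    (f : I -> (V -> R) -> R) : (forall i, is_linear (f i)) ->
  (size s < #|B|)%N ->
  exists d, [/\ exists v, d v != 0, forall v, v \notin B -> d v = 0
    & forall i, i \in s -> f i d = 0].
Proof.
move=> fL ltsB.
pose delta (j : 'I_#|B|) v : R := (v == enum_val j)%:R.
pose A : 'M[R]_(#|B|, size s) := \matrix_(j, l) f (tnth (in_tuple s) l) (delta j).
have /rowV0Pn[a /sub_kermxP aA] : kermx A != 0.
  rewrite kermx_eq0 /row_free neq_ltn.
  by rewrite (leq_ltn_trans (rank_leq_col A)).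
case/rV0Pn=> j0 aj0.
exists (fun v => \sum_(j < #|B|) a ord0 j * delta j v); split.
- exists (enum_val j0); rewrite (bigD1 j0) //= big1 ?addr0.
    by rewrite /delta eqxx mulr1.
  by move=> j /negPf nj; rewrite /delta (inj_eq enum_val_inj) eq_sym nj mulr0.
- move=> v vB; rewrite big1 // => j _; rewrite /delta.
  by case: eqP => [vE|]; [rewrite vE enum_valP in vB | rewrite mulr0].
move=> i; rewrite -[s]/(tval (in_tuple s)) => /tnthP[l ->].
rewrite is_linear_sum //.
have := congr1 (fun B : 'rV_(size s) => B ord0 l) aA; rewrite !mxE => aAl.
apply: etrans aAl.
by apply: eq_bigr => j _; rewrite mxE.
Qed.

Variables (l : J -> (V -> R) -> R) (b : J -> R).
Hypothesis lL : forall j, is_linear (l j).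

Definition feasible z := forall j, l j z <= b j.

Definition tight z : {set J} := [set j | l j z == b j].

(** The tight rows alone determine the point.  For a feasible z this says that
    z is a vertex. *)
Definition extremal z :=
  forall d, (forall j, j \in tight z -> l j d = 0) -> forall v, d v = 0.

(** The recession cone is trivial; a nonempty feasible region is then bounded. *)
Hypothesis l_bounded :
  forall d, (forall j, l j d <= 0) -> forall v, d v = 0.

Variables (u : (V -> R) -> R).
Hypothesis uL : is_linear u.

(** If z is not extreme, it can be moved in a direction that preserves all tight
    rows and, up to sign, does not lower the objective, until one more row
    becomes tight. *)
Lemma extremal_dominates z : feasible z ->
  exists z', [/\ feasible z', u z <= u z' & extremal z'].
Proof.
have [n] := ubnP #|~: tight z|; elim: n z => // n IHn z ltn zF.
have [zE|] := pselect (extremal z); first by exists z.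
move=> /existsNP[d0 /not_implyP[d0T /existsNP[v0 d0v]]].
have [d [dT dv ud]] : exists d, [/\ forall j, j \in tight z -> l j d = 0,
    d v0 != 0 & 0 <= u d].
  move/eqP: d0v => d0v.
  have [ud|ud] := leP 0 (u d0); first by exists d0.
  exists (fun v => -1 * d0 v); split.
  - by move=> j jT; rewrite is_linearZ // d0T // mulr0.
  - by rewrite mulN1r oppr_eq0.
  - by rewrite is_linearZ //; lra.
have [j0 j0d] : exists j, 0 < l j d.
  apply: contrapT => /forallNP H.
  by move/eqP: dv; apply; apply: l_bounded => j; have := H j => /negP; rewrite -leNgt.
(* The step length at which row j would become tight. *)
pose ratio j := (b j - l j z) / l j d.
case: (@arg_minP _ _ _ j0 (fun j => 0 < l j d) ratio j0d) => j1 j1d j1min.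
have t0 : 0 <= ratio j1 by rewrite divr_ge0 ?subr_ge0 // ltW.
set z' := fun v => z v + ratio j1 * d v.
have z'E j : l j z' = l j z + ratio j1 * l j d by rewrite lL.
have z'F : feasible z'.
  move=> j; rewrite z'E; have [jd|jd] := ltP 0 (l j d).
    have := j1min j jd; rewrite -(ler_pM2r jd).
    by rewrite /ratio mulfVK ?(gt_eqF jd) // => H; lra.
  by have := zF j; have := mulr_ge0_le0 t0 jd; lra.
have j1z : j1 \notin tight z by apply/negP => /dT j1E; rewrite j1E ltxx in j1d.
have j1z' : j1 \in tight z'.
  by rewrite inE z'E /ratio mulfVK ?(gt_eqF j1d) // addrC subrK.
have sT : tight z \proper tight z'.
  apply/properP; split; last by exists j1.
  by apply/subsetP => j jT; have := jT; rewrite !inE z'E dT // mulr0 addr0.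
have [|w [wF uw wE]] := IHn z' _ z'F.
  apply: leq_trans (proper_card _) (_ : #|~: tight z| <= n)%N; last by lia.
  by rewrite properC.
exists w; split=> //; apply: le_trans uw.
by rewrite /z' uL lerDl mulr_ge0.
Qed.

Lemma extremal_tight_inj z z' : extremal z -> tight z = tight z' -> z = z'.
Proof.
move=> zE eT; apply/funext => v; apply/eqP; rewrite -subr_eq0; apply/eqP.
apply: (zE (fun v => z v - z' v)) => j jz.
have jz' : j \in tight z' by rewrite -eT.
rewrite (_ : (fun v => _) = fun v => z v + -1 * z' v); last first.
  by apply/funext => w; rewrite mulN1r.
move: jz jz'; rewrite !inE lL => /eqP-> /eqP->; lra.
Qed.

(** An extreme point is determined by its set of tight rows, so choosing one for
    every set of rows leaves finitely many candidates for the maximum. *)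
Lemma maximum_attained z0 : feasible z0 ->
  exists z, feasible z /\ forall z', feasible z' -> u z' <= u z.
Proof.
move=> z0F.
pose vertex T := xget z0 [set z | [/\ feasible z, extremal z & tight z = T]]%classic.
have vertexF T : feasible (vertex T).
  by rewrite /vertex; case: xgetP => [z _ []|].
case: (@arg_maxP _ _ _ finset.set0 xpredT (fun T => u (vertex T)) isT) => T _ Tmax.
exists (vertex T); split=> // z' z'F.
have [w [wF uw wE]] := extremal_dominates z'F.
apply: le_trans uw _; apply: le_trans (Tmax (tight w) isT).
rewrite le_eqVlt (_ : vertex (tight w) = w) ?eqxx //.
rewrite /vertex; case: xgetP => [z _ [_ zE zT]|/(_ w)]; last by case.
exact: extremal_tight_inj.
Qed.

End Programs.

(** * The rank polytope and its tight sets *)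

Section RankPolytope.
Variables (R : realType) (E : finType) (M : matroid E).
Implicit Types (y u : E -> R) (S T C : {set E}).

Definition rank_polytope y : Prop :=
  (forall e, 0 <= y e) /\ forall S, \sum_(e in S) y e <= (rank M S)%:R.

Lemma indep_polytope_rank y : indep_polytope M y -> rank_polytope y.
Proof.
case=> c [c0 c1 yE]; split=> [e|S].
  by rewrite yE sumr_ge0 // => I iI; rewrite mulr_ge0 ?c0 ?ler0n.
rewrite (eq_bigr _ (fun e _ => yE e)) exchange_big /=.
apply: (@le_trans _ _ ((\sum_(I | indep M I) c I) * (rank M S)%:R)); last first.
  by rewrite c1 mul1r.
rewrite mulr_suml ler_sum // => I iI.
rewrite -mulr_sumr ler_wpM2l ?c0 // /incidence -natr_sum ler_nat -big_mkcondr sum1_card /=.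
 apply: leq_trans (leq_card_rank (_ : I :&: S \subset S) _).
- by apply: subset_leq_card; apply/subsetP => e; rewrite !inE => /andP[-> ->].
- exact: subsetIr.
- by apply: indepS iI; exact: subsetIl.
Qed.

(** This is the part of the integrality of the rank polytope that the argument
    consumes.  Subtract the least weight th from all of T: on the elements
    left with positive weight use induction, and extend the set found there to
    a basis of T, so that the part th * y(T) <= th * rank T is gained in full. *)
Lemma weight_le_indep u y T : rank_polytope y -> {in T, forall e, 0 <= u e} ->
  exists I : {set E}, [/\ I \subset T, indep M I
    & \sum_(e in T) u e * y e <= \sum_(e in I) u e].
Proof.
move=> yQ; have [n] := ubnP #|T|; elim: n T u => // n IHn T u ltT u0.
have [T0|[e0 e0T]] := set_0Vmem T.
  by exists finset.set0; rewrite sub0set indep0 T0 !big_set0.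
case: (@arg_minP _ _ _ e0 (mem T) u e0T) => e1 e1T e1min.
set th := u e1.
pose T' := [set e in T | th < u e].
have sT'T : T' \subset T by apply/subsetP => e; rewrite inE => /andP[].
have [||I [sI iI uI]] := IHn T' (fun e => u e - th).
- apply: leq_trans (_ : #|T| <= n)%N; last by lia.
  apply: proper_card; apply/properP; split=> //.
  by exists e1 => //; rewrite inE ltxx andbF.
- by move=> e; rewrite inE => /andP[_ /ltW]; rewrite subr_ge0.
have [B [sIB sBT iB cB]] := extend_to_basis (subset_trans sI sT'T) iI.
exists B; split=> //.
have -> : \sum_(e in T) u e * y e =
    \sum_(e in T) (u e - th) * y e + th * \sum_(e in T) y e.
  by rewrite mulr_sumr -big_split; apply: eq_bigr => e _ /=; ring.
have -> : \sum_(e in B) u e = \sum_(e in B) (u e - th) + th * (rank M T)%:R.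
  by rewrite sumrB sumr_const cB mulr_natr subrK.
apply: lerD; last by rewrite ler_wpM2l ?u0 //; apply: yQ.2.
have -> : \sum_(e in T) (u e - th) * y e = \sum_(e in T') (u e - th) * y e.
  rewrite [LHS](big_setID T') /= (setIidPr sT'T) [X in _ + X]big1 ?addr0 // => e.
  rewrite !inE => /andP[/nandP[/negP//|ne] eT].
  have /eqP -> : u e == th by rewrite eq_le leNgt ne e1min.
  by rewrite subrr mul0r.
apply: le_trans uI _.
rewrite [leRHS](big_setID I) /= (setIidPr sIB) lerDl sumr_ge0 // => e.
by rewrite !inE => /andP[_ /(subsetP sBT) eT]; rewrite subr_ge0 e1min.
Qed.

Definition tight_set y C : bool := \sum_(e in C) y e == (rank M C)%:R.

Lemma tight_set0 y : tight_set y finset.set0.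
Proof.
rewrite /tight_set big_set0 eq_sym pnatr_eq0.
have [I [sI _ <-]] := rank_witness M finset.set0.
by rewrite finset.subset0 -cards_eq0 in sI.
Qed.

(** Uncrossing: y is modular and the rank submodular. *)
Lemma tight_setUI y S T : rank_polytope y -> tight_set y S -> tight_set y T ->
  tight_set y (S :|: T) && tight_set y (S :&: T).
Proof.
move=> [_ yr] /eqP tS /eqP tT; rewrite /tight_set.
have UI : \sum_(e in S :|: T) y e + \sum_(e in S :&: T) y e =
    \sum_(e in S) y e + \sum_(e in T) y e.
  rewrite (big_setID S (A := S :|: T)) /= (big_setID S (A := T)) /=.
  have -> : (S :|: T) :&: S = S by rewrite setUK.
  by rewrite setDUl setDv finset.set0U finset.setIC; ring.
have := rank_submod M S T; rewrite -(ler_nat R) !natrD.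
have := yr (S :|: T); have := yr (S :&: T).
by move=> *; apply/andP; split; apply/eqP; lra.
Qed.

(** Dropping the zero coordinates keeps y(C) and cannot raise the rank. *)
Lemma tight_set_support y C : rank_polytope y -> tight_set y C ->
  tight_set y [set e in C | y e != 0].
Proof.
move=> [y0 yr] /eqP tC; rewrite /tight_set eq_le yr /=.
have -> : \sum_(e in [set e in C | y e != 0]) y e = \sum_(e in C) y e.
  rewrite [RHS](bigID (fun e => y e != 0)) /= [X in _ + X]big1 ?addr0.
    by apply: eq_bigl => e; rewrite inE.
  by move=> e /andP[_ /negPn/eqP].
rewrite tC ler_nat; have [I [sI iI <-]] := rank_witness M [set e in C | y e != 0].
apply: leq_card_rank => //.
by apply: subset_trans sI _; apply/subsetP => e; rewrite inE => /andP[].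
Qed.

(** A maximal chain of tight sets inside the support spans all of them, by
    uncrossing.  Along the chain y(C) takes strictly increasing values, which
    are ranks and hence integers, so its length is at most y(E). *)
Lemma tight_sets_spanned y : rank_polytope y -> exists s : seq {set E},
  (size s)%:R <= \sum_e y e /\
  forall d : E -> R, {in s, forall C, \sum_(e in C) d e = 0} ->
    forall C, {in C, forall e, y e != 0} -> tight_set y C -> \sum_(e in C) d e = 0.
Proof.
move=> yQ; have [y0 yr] := yQ.
pose supp := [set e | y e != 0].
pose P (C : {set E}) := (C \subset supp) && tight_set y C.
have P0 : P finset.set0 by rewrite /P sub0set tight_set0.
have PUI C D : P C -> P D -> P (C :|: D) && P (C :&: D).
  move=> /andP[sC tC] /andP[sD tD]; have /andP[tU tI] := tight_setUI yQ tC tD.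
  by rewrite /P tU tI subUset sC sD subIset ?sC.
have main U : P U -> exists s : seq {set E}, (size s <= rank M U)%N /\
  forall d : E -> R, {in s, forall C, \sum_(e in C) d e = 0} ->
    forall C, P C -> C \subset U -> \sum_(e in C) d e = 0.
  have [n] := ubnP #|U|; elim: n U => // n IHn U ltU PU.
  have [U0|neU] := eqVneq U finset.set0.
    exists [::]; split=> // d _ C _; rewrite U0 subset0 => /eqP->.
    by rewrite big_set0.
  (* D is the predecessor of U in the chain. *)
  have P0' : P finset.set0 && (finset.set0 \proper U) by rewrite P0 proper0.
  case: (@arg_maxnP _ _ (fun C : {set E} => P C && (C \proper U))
    (fun C => #|C|) P0') => D /andP[PD pD] Dmax.
  have [|s [szs sD]] := IHn D _ PD.
    by apply: leq_trans (proper_card pD) _; lia.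
  exists (U :: s); split.
    apply: leq_ltn_trans szs _; rewrite -(ltr_nat R).
    have /andP[_ /eqP <-] := PU; have /andP[_ /eqP <-] := PD.
    have /properP[sDU [e eU eD]] := pD.
    rewrite [ltRHS](big_setID D) /= (setIidPr sDU) ltrDl (bigD1 e) ?inE ?eD //=.
    rewrite ltr_wpDr ?sumr_ge0 // lt_def y0 andbT.
    by have /andP[/subsetP/(_ e eU)] := PU; rewrite inE.
  move=> d ds C PC sCU.
  have dD C' : P C' -> C' \subset D -> \sum_(e in C') d e = 0.
    by apply: sD => C'' C''s; apply: ds; rewrite inE C''s orbT.
  have /andP[PCD PCD'] := PUI _ _ PC PD.
  have sDU := proper_sub pD.
  have sCD : C :|: D \subset U by rewrite subUset sCU.
  (* C :|: D lies between D and U in the lattice of tight sets, so by the choice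
     of D it is one of them. *)
  have [eU|neCD] := eqVneq (C :|: D) U; last first.
    apply: dD => //; have pCD : C :|: D \proper U by rewrite properEneq neCD.
    have := Dmax (C :|: D); rewrite PCD pCD => /(_ isT) leD.
    have /eqP -> : D == C :|: D by rewrite eqEcard subsetUr.
    exact: subsetUl.
  have dU : \sum_(e in U) d e = 0 by apply: ds; rewrite inE eqxx.
  have dI : \sum_(e in C :&: D) d e = 0 by apply: dD => //; exact: subsetIr.
  move: dU; rewrite -eU [LHS](big_setID D) /= finset.setIC setKU dD //.
  rewrite add0r setDUl setDv finset.setU0 => dCD.
  by rewrite (big_setID D) /= dI dCD addr0.
case: (@arg_maxnP _ _ P (fun C => #|C|) P0) => U PU Umax.
have [s [szs sU]] := main U PU.
exists s; split.
  apply: le_trans (_ : (rank M U)%:R <= _); first by rewrite ler_nat.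
  have /andP[_ /eqP <-] := PU.
  by rewrite [leRHS](bigID (mem U)) /= lerDl sumr_ge0.
move=> d ds C Csupp tC; have PC : P C.
  by rewrite /P tC andbT; apply/subsetP => e /Csupp; rewrite inE.
apply: sU => //; have /andP[PCU _] := PUI _ _ PC PU.
have /eqP -> : U == C :|: U by rewrite eqEcard subsetUr; apply: Umax.
exact: subsetUl.
Qed.

End RankPolytope.

(** * Points of k rank polytopes that agree on a set *)

Section Coupled.
Variables (R : realType) (k : nat) (E : finType) (M : 'I_k -> matroid E).
Variable (A : {set E}).
Implicit Types (z d : 'I_k * E -> R) (i j : 'I_k).

Definition coupled z : Prop :=
  (forall i, rank_polytope (M i) (fun e => z (i, e))) /\
  (forall i j, {in A, forall e, z (i, e) = z (j, e)}).

(** Rows: nonnegativity, rank inequalities, and for each e in A and each ordered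
    pair (i, j) the inequality z(i, e) <= z(j, e).  The two orders of a pair make
    an equation, which is tight at every feasible point. *)
Definition coupled_row
    (c : 'I_k * E + 'I_k * {set E} + 'I_k * 'I_k * E) z : R :=
  match c with
  | inl (inl v) => - z v
  | inl (inr (i, U)) => \sum_(e in U) z (i, e)
  | inr (i, j, e) => if e \in A then z (i, e) - z (j, e) else 0
  end.

Definition coupled_bound (c : 'I_k * E + 'I_k * {set E} + 'I_k * 'I_k * E) : R :=
  if c is inl (inr (i, U)) then (rank (M i) U)%:R else 0.

Lemma coupled_row_linear c : is_linear (coupled_row c).
Proof.
case: c => [[v|[i S]]|[[i j] e]] z d t /=; first by ring.
- by rewrite big_split mulr_sumr.
- by case: ifP => _; ring.
Qed.

Lemma coupledP z : coupled z <-> feasible coupled_row coupled_bound z.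
Proof.
split=> [[zQ zA] [[[i e]|[i S]]|[[i j] e]] /=|zF].
- by rewrite oppr_le0; apply: (zQ i).1.
- exact: (zQ i).2.
- by case: ifP => // eA; rewrite (zA i j) // subrr.
split=> [i|i j e eA].
  split=> [e|S]; last by have := zF (inl (inr (i, S))).
  by have := zF (inl (inl (i, e))); rewrite /= oppr_le0.
have := zF (inr (i, j, e)); have := zF (inr (j, i, e)); rewrite /= eA; lra.
Qed.

Lemma coupled_row_bounded d :
  (forall c, coupled_row c d <= 0) -> forall v, d v = 0.
Proof.
move=> d0 [i e]; have := d0 (inl (inl (i, e))).
have := d0 (inl (inr (i, [set e]))); rewrite /= big_set1; lra.
Qed.

(** The free unknowns are the nonzero coordinates of z, with the k copies of an
    element of A counted once, through i0.  The equations are the spanning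
    tight sets of all i, at most the sum of all z(i, e) in number.  An element e
    of A contributes k z(i0, e) < 1 to that sum, and any other coordinate at
    most 1 because ranks of singletons are at most 1; so there would be fewer
    equations than unknowns. *)
Lemma extremal_large_coordinate z i0 : coupled z ->
  extremal coupled_row coupled_bound z ->
  (forall i, {in A, forall e, z (i, e) = 0}) \/
  exists2 e, e \in A & k%:R^-1 <= z (i0, e).
Proof.
move=> [zQ zA] zE.
have [[i1 [e1 e1A z1]]|z0] :=
    pselect (exists i, exists2 e, e \in A & z (i, e) <> 0); last first.
  by left=> i e eA; apply: contrapT => zie; apply: z0; exists i, e.
right; apply: contrapT => small.
have {}small e : e \in A -> z (i0, e) < k%:R^-1.
  by move=> eA; rewrite ltNge; apply/negP => ze; apply: small; exists e.
have k0 : 0 < k%:R :> R by rewrite ltr0n (leq_ltn_trans _ (ltn_ord i0)).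
have z1' : z (i0, e1) != 0 by apply/eqP; rewrite (zA _ i1).
pose B := [set v : 'I_k * E | (z v != 0) && ((v.2 \in A) ==> (v.1 == i0))].
have [s sP] := choice (fun i => tight_sets_spanned (zQ i)).
pose rows := [seq (i, C) | i <- enum 'I_k, C <- s i].
(* Copies the coordinates (i0, e) with e in A to all i. *)
pose extend d (v : 'I_k * E) := if v.2 \in A then d (i0, v.2) else d v.
have few_rows : (size rows < #|B|)%N.
  rewrite size_allpairs_dep -(ltr_nat R) sumnE big_map natr_sum big_enum /=.
  apply: (@le_lt_trans _ _ (\sum_i \sum_e z (i, e))).
    by apply: ler_sum => i _; exact: (sP i).1.
  have -> : (#|B|)%:R = \sum_e \sum_i ((i, e) \in B)%:R :> R.
    rewrite exchange_big /= pair_big -sum1_card natr_sum big_mkcond /=.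
    by apply: eq_bigr => -[i e] _ /=; case: ifP.
  rewrite exchange_big /=.
  have small' e : e \in A -> k%:R * z (i0, e) < 1.
    by move=> eA; rewrite mulrC -ltr_pdivlMr // mul1r small.
  have zi e i : e \in A -> z (i, e) = z (i0, e) by move=> eA; apply: zA.
  have inner e : e \in A -> \sum_i z (i, e) = k%:R * z (i0, e).
    move=> eA; rewrite (eq_bigr _ (fun i _ => zi e i eA)).
    by rewrite sumr_const card_ord mulr_natl.
  have innerB e : e \in A -> \sum_i ((i, e) \in B)%:R = (z (i0, e) != 0)%:R :> R.
    move=> eA; rewrite (bigD1 i0) //= inE /= eA eqxx andbT big1 ?addr0 // => i ii0.
    by rewrite inE /= eA (negPf ii0) andbF.
  have lez e : \sum_i z (i, e) <= \sum_i ((i, e) \in B)%:R.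
    have [eA|eA] := boolP (e \in A).
      rewrite inner // innerB //; have [->|_] := eqVneq; first by rewrite mulr0.
      by apply/ltW; exact: small'.
    apply: ler_sum => i _; rewrite inE /= (negPf eA) andbT.
    have [->//|_] := eqVneq.
    have := (zQ i).2 [set e]; rewrite big_set1 => /le_trans; apply.
    by rewrite (ler_nat R _ 1) rank1.
  rewrite (bigD1 e1) //= [ltRHS](bigD1 e1) //=.
  apply: ltr_leD; last by apply: ler_sum.
  by rewrite inner // innerB // z1' small'.
pose row (c : 'I_k * {set E}) d := \sum_(e in c.2) extend d (c.1, e).
have rowL c : is_linear (row c).
  move=> x d t; rewrite /row mulr_sumr -big_split; apply: eq_bigr => e _ /=.
  by rewrite /extend; case: ifP.
have [d [[v dv] dB drow]] := nonzero_solution rowL few_rows.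
have d_supp w : z w = 0 -> extend d w = 0.
  move=> zw; rewrite /extend; case: ifP => wA; apply: dB; rewrite inE /=.
    by rewrite (zA _ w.1) // -surjective_pairing zw eqxx.
  by rewrite zw eqxx.
have dE : extend d v = d v.
  have : v \in B by apply: contraNT dv => /dB ->.
  rewrite inE /extend => /andP[_ /implyP vi]; case: ifP => // /vi /eqP <-.
  by rewrite -surjective_pairing.
case/eqP: dv; rewrite -dE; apply: zE => {v dE} c.
rewrite inE /coupled_bound; case: c => [[v|[i S]]|[[i j] e]] /=.
- by rewrite oppr_eq0 => /eqP zv; rewrite d_supp ?oppr0.
- move=> tS; rewrite (bigID (fun e => z (i, e) != 0)) /= [X in _ + X]big1 ?addr0.
    rewrite (eq_bigl (fun e => e \in [set e in S | z (i, e) != 0])); last first.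
      by move=> e; rewrite inE.
    rewrite (sP i).2 //.
    + move=> C Cs; apply: (drow (i, C)); apply/allpairsPdep.
      by exists i, C; rewrite mem_enum.
    + by move=> e; rewrite inE => /andP[].
    + exact: tight_set_support.
  by move=> e /andP[_ /negPn/eqP/d_supp].
- by case: ifP => // eA _; rewrite /extend /= eA subrr.
Qed.

End Coupled.

(** * Local ratio *)

Section BestCompletion.
Variables (R : realType) (E : finType) (M : matroid E).
Implicit Types (u : E -> R) (T K J : {set E}) (e : E).

(** For K independent this is the maximal weight of a set that completes K inside
    T; the default value 0 is then the weight of the empty completion. *)
Definition best u T K : R :=
  \big[Num.max/0]_(J : {set E} | (J \subset T) && indep M (K :|: J)) \sum_(e in J) u e.

Lemma le_best u T K J : J \subset T -> indep M (K :|: J) ->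
  \sum_(e in J) u e <= best u T K.
Proof.
move=> sJ iJ.
by apply: (@le_bigmax_cond _ _ _ _ J _ (fun J => \sum_(e in J) u e)); rewrite sJ.
Qed.

Lemma best_witness u T K : indep M K -> exists J,
  [/\ J \subset T, indep M (K :|: J) & best u T K = \sum_(e in J) u e].
Proof.
move=> iK.
have P0 : (finset.set0 \subset T) && indep M (K :|: finset.set0).
  by rewrite sub0set finset.setU0.
case: (@arg_maxP _ _ _ _ (fun J => (J \subset T) && indep M (K :|: J))
  (fun J => \sum_(e in J) u e) P0) => J /andP[sJ iJ] Jmax.
exists J; split=> //; apply/eqP; rewrite eq_le le_best // andbT.
apply: bigmax_le => //; first by have := Jmax _ P0; rewrite big_set0.
Qed.

(** As e is not in T, symmetric exchange trades e in a best completion of e |: K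
    for at most one element t of a best unconstrained set; the two sets obtained
    have the same total weight and compete for K and for [set e]. *)
Lemma best_submod u T K e : e \notin T -> e \notin K -> indep M (e |: K) ->
  best u T (e |: K) + best u T finset.set0 <= best u T K + best u T [set e].
Proof.
move=> eT eK iK.
have [J1 [sJ1 iJ1 ->]] := best_witness u T iK.
have [J2 [sJ2 + ->]] := best_witness u T (indep0 M).
rewrite finset.set0U => iJ2.
have [ieJ2|dJ2] := boolP (indep M (e |: J2)).
  apply: lerD; apply: le_best => //.
  by apply: indepS iJ1; rewrite finset.setSU // subsetUr.
have eX : e \in (e |: K) :|: J1 by rewrite !inE eqxx.
have [t [tJ2 tX it iet]] := symmetric_exchange iJ1 iJ2 eX dJ2.
have tJ1 : t \notin J1 by apply: contra tX; rewrite inE => ->; rewrite orbT.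
have -> : \sum_(f in J1) u f + \sum_(f in J2) u f =
    \sum_(f in t |: J1) u f + \sum_(f in J2 :\ t) u f.
  by rewrite (big_setU1 _ tJ1) (big_setD1 _ tJ2) /=; ring.
apply: lerD; apply: le_best => //.
- by rewrite subUset sub1set (subsetP sJ2).
- apply: indepS it; apply/subsetP => f; rewrite !inE.
  case: (f =P e) => [->|_]; last by case: (f == t); case: (f \in K).
  rewrite (negPf eK) /= => /orP[->//|eJ1].
  by rewrite (subsetP sJ1) in eT.
- by apply: subset_trans sJ2; exact: subD1set.
Qed.

(** The effect of adding to T an element e whose weight exceeds by g the loss
    caused by forcing e in. *)
Section Push.
Variables (u u' : E -> R) (T : {set E}) (e : E) (g : R).
Hypotheses (eT : e \notin T) (ie : indep M [set e]) (g0 : 0 <= g).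
Hypothesis u'T : {in T, forall f, u' f = u f}.
Hypothesis u'e : u' e = best u T finset.set0 - best u T [set e] + g.

Let sum_u' J : J \subset T -> \sum_(f in J) u' f = \sum_(f in J) u f.
Proof. by move=> sJ; apply: eq_bigr => f /(subsetP sJ) /u'T. Qed.

(** The two cases are whether a best completion in e |: T avoids or uses e. *)
Lemma best_push_le K : indep M K ->
  best u' (e |: T) K <= best u T K \/
  indep M (e |: K) /\ best u' (e |: T) K <= best u T (e |: K) + u' e.
Proof.
move=> iK; have [J [sJ iJ ->]] := best_witness u' (e |: T) iK.
have [eJ|eJ] := boolP (e \in J); last first.
  have sJT : J \subset T.
    apply/subsetP => f fJ; have := subsetP sJ f fJ; rewrite !inE => /orP[/eqP fe|//].
    by rewrite -fe fJ in eJ.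
  by left; rewrite sum_u' //; apply: le_best.
have sJT : J :\ e \subset T by rewrite subDset.
right; split.
  by apply: indepS iJ; rewrite subUset sub1set !inE eJ orbT subsetUl.
rewrite (big_setD1 _ eJ) /= addrC lerD2r sum_u' // le_best //.
apply: indepS iJ; rewrite subUset subUset sub1set !inE eJ orbT subsetUl /=.
by apply: subset_trans (subsetUr _ _); exact: subD1set.
Qed.

Lemma best_push : best u' (e |: T) finset.set0 = best u T finset.set0 + g.
Proof.
apply/eqP; rewrite eq_le; apply/andP; split.
  have [|[_]] := best_push_le (indep0 M); first by have := g0; lra.
  by rewrite finset.setU0 u'e; lra.
have [J [sJ iJ bJ]] := best_witness u T ie.
have eJ : e \notin J by apply: contra eT => /(subsetP sJ).
have -> : best u T finset.set0 + g = \sum_(f in e |: J) u' f.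
  by rewrite big_setU1 //= sum_u' // u'e bJ; ring.
by apply: le_best; rewrite ?finset.setUS // finset.set0U.
Qed.

End Push.
End BestCompletion.

Section LocalRatio.
Variables (R : realType) (k : nat) (E : finType) (M : 'I_k -> matroid E).
Variables (w : E -> R) (i0 : 'I_k).
Implicit Types (A I : {set E}) (u : 'I_k -> E -> R) (z : 'I_k * E -> R).

Local Notation gap := (k%:R - 1 + k%:R^-1 : R).

(** What is gained by taking I among the active elements: its weight, minus what
    the retired elements lose in each matroid by having to leave room for I. *)
Definition residual u A I : R :=
  \sum_(e in I) w e +
  \sum_i (best (M i) (u i) (~: A) I - best (M i) (u i) (~: A) finset.set0).

(** Going from u' to u costs nothing in any matroid, by [best_submod], and saves
    g in a matroid where the best completion of I does not use e; then I itself
    will do, as it does for g = 0.  If g > 0 and the best completions of I use e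
    in all matroids, then e can be added to I: it brings w e, which pays for
    sum_i c i and leaves g. *)
Lemma residual_push A u u' e (c : 'I_k -> R) (g : R) I :
    e \in A -> (forall i, indep (M i) [set e]) ->
    (forall i, c i = best (M i) (u i) (~: A) finset.set0
                     - best (M i) (u i) (~: A) [set e]) ->
    g = Num.max 0 (w e - \sum_i c i) ->
    (forall i f, u' i f = if f == e then c i + g else u i f) ->
    I \subset A :\ e -> (forall i, indep (M i) I) ->
  exists I', [/\ I' \subset A, forall i, indep (M i) I' &
    g + residual u' (A :\ e) I <= residual u A I'].
Proof.
move=> eA ie cE gE u'E sI iI.
have g0 : 0 <= g by rewrite gE le_max lexx.
have eT : e \notin ~: A by rewrite inE eA.
have eI : e \notin I by apply/negP => /(subsetP sI); rewrite !inE eqxx.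
have TE : ~: (A :\ e) = e |: ~: A.
  by apply/setP => f; rewrite !inE; case: (f == e).
have u'T i : {in ~: A, forall f, u' i f = u i f}.
  by move=> f; rewrite inE u'E; case: eqP => [->|//]; rewrite eA.
have u'e i : u' i e = best (M i) (u i) (~: A) finset.set0
                     - best (M i) (u i) (~: A) [set e] + g.
  by rewrite u'E eqxx cE.
have push0 i := best_push eT (ie i) g0 (u'T i) (u'e i).
have push i := best_push_le e (u'T i) (iI i).
rewrite /residual TE.
have sIA : I \subset A by apply: subset_trans sI _; exact: subD1set.
have keep i : best (M i) (u' i) (e |: ~: A) I - best (M i) (u' i) (e |: ~: A) finset.set0
    <= best (M i) (u i) (~: A) I - best (M i) (u i) (~: A) finset.set0.
  rewrite push0; have [|[ieI]] := push i; first by lra.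
  by have := best_submod (u i) eT eI ieI; rewrite u'e; lra.
have [gz|gnz] := eqVneq g 0.
  by exists I; split=> //; rewrite gz add0r lerD2l; apply: ler_sum.
have gw : g = w e - \sum_i c i.
  by move: gnz; rewrite gE; case: (leP (w e - _) 0) => //; rewrite eqxx.
have [[j jle]|all_right] := pselect (exists j,
    best (M j) (u' j) (e |: ~: A) I <= best (M j) (u j) (~: A) I).
  exists I; split=> //; rewrite addrCA lerD2l.
  rewrite (bigD1 j) //= [leRHS](bigD1 j) //= addrA.
  apply: lerD; last by apply: ler_sum.
  by rewrite push0; lra.
have right_ i : indep (M i) (e |: I) /\
    best (M i) (u' i) (e |: ~: A) I <= best (M i) (u i) (~: A) (e |: I) + u' i e.
  by case: (push i) => // ile; case: all_right; exists i.
exists (e |: I); split=> [|i|].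
- by rewrite subUset sub1set eA.
- exact: (right_ i).1.
have : \sum_i (best (M i) (u' i) (e |: ~: A) I
                - best (M i) (u' i) (e |: ~: A) finset.set0) <=
    \sum_i (best (M i) (u i) (~: A) (e |: I)
            - best (M i) (u i) (~: A) finset.set0) + \sum_i c i.
  rewrite -big_split; apply: ler_sum => i _ /=; rewrite push0 cE.
  by have := (right_ i).2; rewrite u'e; lra.
rewrite big_setU1 //=; lra.
Qed.

(** Since the points agree on A, prescribing the sum of the weights u i there
    fixes the objective, and all points can be treated alike in one double sum.
    At an extreme point either x vanishes on A, where the matroid optima bound
    the objective, or an element with x_e >= 1/k is retired. *)
Lemma local_ratio A u z : coupled M A z ->
    (forall i e, e \notin A -> 0 <= u i e) ->
    {in A, forall e, \sum_i u i e = w e} ->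
  exists I, [/\ I \subset A, forall i, indep (M i) I &
    \sum_i \sum_e u i e * z (i, e) <=
      \sum_i best (M i) (u i) (~: A) finset.set0 + gap * residual u A I].
Proof.
have k1 : 1 <= k%:R :> R by rewrite ler1n (leq_ltn_trans _ (ltn_ord i0)).
have kV0 : 0 < k%:R^-1 :> R by rewrite invr_gt0; lra.
have [n] := ubnP #|A|; elim: n A u z => // n IHn A u z ltA zC u0 uw.
pose obj (z : 'I_k * E -> R) := \sum_i \sum_e u i e * z (i, e).
have objL : is_linear obj.
  move=> x d t; rewrite /obj mulr_sumr -big_split /=; apply: eq_bigr => i _.
  by rewrite mulr_sumr -big_split; apply: eq_bigr => e _ /=; ring.
have [z' [/coupledP z'C zz' z'E]] := extremal_dominates (coupled_row_linear A)
  (@coupled_row_bounded _ _ _ A) objL ((coupledP M A z).1 zC).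
suff [I [sI iI leI]] : exists I, [/\ I \subset A, forall i, indep (M i) I &
    obj z' <= \sum_i best (M i) (u i) (~: A) finset.set0 + gap * residual u A I].
  by exists I; split=> //; apply: le_trans leI.
move=> {z zC zz'}; move: z' z'C z'E => z zC zE.
have [zA0|[e eA ze]] := extremal_large_coordinate i0 zC zE.
  exists finset.set0; split=> [|i|]; [exact: sub0set | exact: indep0 |].
  rewrite /residual big_set0 add0r [X in gap * X]big1 => [|i _]; last first.
    exact: subrr.
  rewrite mulr0 addr0; apply: ler_sum => i _.
  have u0' : {in ~: A, forall e, 0 <= u i e} by move=> e; rewrite inE => /u0.
  have [J [sJ iJ leJ]] := weight_le_indep (zC.1 i) u0'.
  have -> : \sum_e u i e * z (i, e) = \sum_(e in ~: A) u i e * z (i, e).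
    rewrite (bigID (fun e => e \in ~: A)) /= [X in _ + X]big1 ?addr0 // => e.
    by rewrite inE negbK => eA; rewrite zA0 // mulr0.
  by apply: le_trans leJ _; apply: le_best; rewrite ?finset.set0U.
have ie i : indep (M i) [set e].
  apply: rank1_indep; rewrite -(ltr_nat R); apply: lt_le_trans kV0 _.
  apply: le_trans ze _; rewrite (zC.2 i0 i) //.
  by have := (zC.1 i).2 [set e]; rewrite big_set1.
pose c i := best (M i) (u i) (~: A) finset.set0 - best (M i) (u i) (~: A) [set e].
pose g : R := Num.max 0 (w e - \sum_i c i).
pose u' i f := if f == e then c i + g else u i f.
have g0 : 0 <= g by rewrite le_max lexx.
have eT : e \notin ~: A by rewrite inE eA.
have TE : ~: (A :\ e) = e |: ~: A.
  by apply/setP => f; rewrite !inE; case: (f == e).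
have c0 i : 0 <= c i.
  rewrite subr_ge0; have [J [sJ iJ ->]] := best_witness (u i) (~: A) (ie i).
  by apply: le_best; rewrite // finset.set0U; apply: indepS iJ; exact: subsetUr.
have [||||I [sI iI leI]] := IHn (A :\ e) u' z.
- by rewrite (cardsD1 e A) eA in ltA; lia.
- by split; [exact: zC.1 | move=> i j f; rewrite inE => /andP[_ fA]; apply: zC.2].
- move=> i f; rewrite /u'; case: eqP => [_ _|/eqP fe]; first by rewrite addr_ge0.
  by rewrite !inE fe => /u0.
- move=> f; rewrite !inE => /andP[/negPf fe fA]; rewrite -uw //.
  by apply: eq_bigr => i _; rewrite /u' fe.
have [I' [sI' iI' leI']] := @residual_push A u u' e c g I eA ie
  (fun=> erefl) erefl (fun _ _ => erefl) sI iI.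
exists I'; split=> //.
have u'e i : u' i e = best (M i) (u i) (~: A) finset.set0
                     - best (M i) (u i) (~: A) [set e] + g.
  by rewrite /u' eqxx.
have u'T i : {in ~: A, forall f, u' i f = u i f}.
  by move=> f; rewrite inE /u'; case: eqP => [->|//]; rewrite eA.
have best'E : \sum_i best (M i) (u' i) (~: (A :\ e)) finset.set0 =
    \sum_i best (M i) (u i) (~: A) finset.set0 + k%:R * g.
  rewrite TE (eq_bigr _ (fun i _ => best_push eT (ie i) g0 (u'T i) (u'e i))).
  by rewrite big_split sumr_const card_ord mulr_natl.
have obj'E : \sum_i \sum_f u' i f * z (i, f) =
    obj z + z (i0, e) * (\sum_i c i + k%:R * g - w e).
  rewrite -uw // mulrBr mulrDr mulr_sumr mulr_sumr.
  have -> : z (i0, e) * (k%:R * g) = \sum_(i < k) z (i0, e) * g.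
    by rewrite sumr_const card_ord -mulr_natl; ring.
  rewrite -big_split -sumrB -big_split; apply: eq_bigr => i _ /=.
  rewrite (bigD1 e) //= [X in _ = X + _](bigD1 e) //= (zC.2 i0 i) // /u' eqxx.
  rewrite (eq_bigr (fun f => u i f * z (i, f))) => [|f /negPf -> //].
  ring.
rewrite best'E obj'E in leI.
have gap0 : 0 <= gap by lra.
have := ler_wpM2l gap0 leI'; rewrite mulrDr.
(* Only g >= w e - sum_i c i enters, so the case g = 0 is covered as well. *)
have gain : (k%:R - 1) * g <= \sum_i c i + k%:R * g - w e.
  have : w e - \sum_i c i <= g by rewrite le_max lexx orbT.
  lra.
have k1g : 0 <= (k%:R - 1) * g by rewrite mulr_ge0 //; lra.
have : k%:R^-1 * ((k%:R - 1) * g) <= z (i0, e) * (\sum_i c i + k%:R * g - w e).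
  by apply: ler_pM => //; exact: ltW.
have -> : k%:R^-1 * ((k%:R - 1) * g) = g - k%:R^-1 * g.
  by rewrite mulrA mulrBr mulr1 mulVf ?mulrBl ?mul1r //; apply/eqP; lra.
(* The optima grew by k g in all and the objective by g - g / k at least, and
   the difference of the two is gap * g. *)
rewrite -/(obj z) !mulrDl mulN1r; lra.
Qed.

(** At the start everything is active, so that the only completion in any
    matroid is the empty one. *)
Lemma lp_gap (x : E -> R) : (forall i, rank_polytope (M i) x) ->
  exists I, (forall i, indep (M i) I) /\
    \sum_e w e * x e <= gap * \sum_(e in I) w e.
Proof.
move=> xQ.
pose u (i : 'I_k) e := if i == i0 then w e else 0.
have uE e : \sum_i u i e = w e.
  rewrite (bigD1 i0) //= /u eqxx big1 ?addr0 // => i /negPf -> //.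
have [|||I [_ iI]] := @local_ratio finset.setT u (fun v => x v.2) _ _ _.
- by split=> // i j e _.
- by move=> i e; rewrite inE.
- by move=> e _; rewrite uE.
have best0 i K : indep (M i) K -> best (M i) (u i) (~: finset.setT) K = 0.
  move=> iK; have [J [+ _ ->]] := best_witness (u i) (~: finset.setT) iK.
  by rewrite finset.setCT finset.subset0 => /eqP ->; rewrite big_set0.
have -> : \sum_i \sum_e u i e * x e = \sum_e w e * x e.
  by rewrite exchange_big; apply: eq_bigr => e _ /=; rewrite -mulr_suml uE.
rewrite /residual [\sum_i (_ - _)]big1 => [|i _]; last by rewrite !best0 ?indep0 ?subrr.
rewrite [\sum_i best _ _ _ _]big1 => [|i _]; last by rewrite best0 ?indep0.
by rewrite add0r addr0 => leI; exists I.
Qed.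

End LocalRatio.

(** * Attainment of the two maxima, and the gap *)

Section LpMaximum.
Variables (R : realType) (k : nat) (E : finType) (M : 'I_k -> matroid E).
Variable (w : E -> R).
Implicit Types (z d : 'I_k * {set E} -> R) (i j : 'I_k).

Definition marginal z i e : R := \sum_(I : {set E}) z (i, I) * incidence R I e.

(** The rows express that the z(i, I) are, for each i, the coefficients of a
    convex combination (vanishing on dependent sets), and that the k points so
    described coincide.  The boolean is the sign with which the normalisation
    sum_I z(i, I) = 1 is split into two inequalities. *)
Definition coef_index : finType :=
  ('I_k * {set E} + 'I_k * {set E} + 'I_k * bool + 'I_k * 'I_k * E)%type.

Definition coef_row (c : coef_index) z : R :=
  match c with
  | inl (inl (inl v)) => - z v
  | inl (inl (inr (i, U))) => if indep (M i) U then 0 else z (i, U)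
  | inl (inr (i, s)) => (-1) ^+ s * \sum_I z (i, I)
  | inr (i, j, e) => marginal z i e - marginal z j e
  end.

Definition coef_bound (c : coef_index) : R :=
  if c is inl (inr (i, s)) then (-1) ^+ s else 0.

Lemma marginal_linear i e : is_linear (fun z => marginal z i e).
Proof.
move=> z d t; rewrite /marginal mulr_sumr -big_split.
by apply: eq_bigr => I _ /=; ring.
Qed.

Lemma coef_row_linear c : is_linear (coef_row c).
Proof.
case: c => [[[v|[i I]]|[i s]]|[[i j] e]] z d t /=; first by ring.
- by case: ifP => _; ring.
- by rewrite big_split -mulr_sumr /=; ring.
- by rewrite !marginal_linear; ring.
Qed.

Lemma coef_row_bounded d : (forall c, coef_row c d <= 0) -> forall v, d v = 0.
Proof.
move=> d_le [i I]; have d0 v : 0 <= d v.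
  by have := d_le (inl (inl (inl v))); rewrite /= oppr_le0.
have := d_le (inl (inr (i, false))); rewrite /= expr0 mul1r (bigD1 I) //=.
have : 0 <= \sum_(J | J != I) d (i, J) by apply: sumr_ge0.
by have := d0 (i, I); lra.
Qed.

Lemma feasible_marginal z : feasible coef_row coef_bound z ->
  forall i j, indep_polytope (M i) (marginal z j).
Proof.
move=> zF i j.
have z0 I : ~~ indep (M i) I -> z (i, I) = 0.
  move=> dI; have := zF (inl (inl (inl (i, I)))).
  by have := zF (inl (inl (inr (i, I)))); rewrite /= (negPf dI); lra.
exists (fun I => z (i, I)); split=> [I _||e].
- by have := zF (inl (inl (inl (i, I)))); rewrite /= oppr_le0.
- have := zF (inl (inr (i, false))); have := zF (inl (inr (i, true))).
  rewrite /= expr0 expr1 (bigID (indep (M i))) /=.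
  rewrite [X in _ + X]big1 => [|I dI]; last by rewrite z0.
  lra.
- have -> : marginal z j e = marginal z i e.
    by have := zF (inr (i, j, e)); have := zF (inr (j, i, e)); rewrite /=; lra.
  rewrite /marginal (bigID (indep (M i))) /= [X in _ + X]big1 ?addr0 // => I dI.
  by rewrite z0 ?mul0r.
Qed.

Lemma feasible_coef (x : E -> R) : (forall i, indep_polytope (M i) x) ->
  exists2 z, feasible coef_row coef_bound z & forall i, marginal z i = x.
Proof.
move=> /choice[c cP].
pose z (v : 'I_k * {set E}) := if indep (M v.1) v.2 then c v.1 v.2 else 0.
have zx i : marginal z i = x.
  apply/funext => e; have [_ _ ->] := cP i.
  rewrite [RHS]big_mkcond; apply: eq_bigr => I _.
  by rewrite /z /=; case: ifP => _; rewrite ?mul0r.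
exists z => //; case=> [[[[i I]|[i I]]|[i s]]|[[i j] e]] /=.
- by rewrite oppr_le0 /z /=; case: ifP => // iI; have [+ _ _] := cP i; apply.
- by rewrite /z /=; case: ifP => // ->.
- have [_ c1 _] := cP i; rewrite /z -big_mkcond /= c1 mulr1 //.
- by rewrite !zx subrr.
Qed.

Lemma lp_maximum_attained (i0 : 'I_k) :
  exists lp, is_maximum (lp_values M w) lp.
Proof.
pose value z := \sum_e w e * marginal z i0 e.
have valueL : is_linear value.
  move=> z d t; rewrite /value mulr_sumr -big_split; apply: eq_bigr => e _ /=.
  by rewrite marginal_linear; ring.
have [z0 z0F _] : exists2 z, feasible coef_row coef_bound z &
    forall i, marginal z i = fun=> 0.
  apply: feasible_coef => i; exists (fun I => (I == finset.set0)%:R); split.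
  - by move=> I _; apply: ler0n.
  - rewrite (bigD1 finset.set0) ?indep0 //= eqxx big1 ?addr0 // => I /andP[_].
    by move=> /negPf ->.
  - move=> e; rewrite big1 // => I _; rewrite /incidence.
    by case: eqP => [->|_]; rewrite ?inE ?mulr0 ?mul0r.
have [z [zF zmax]] :=
  maximum_attained coef_row_linear coef_row_bounded valueL z0F.
exists (value z); split.
  by exists (marginal z i0) => // i _; apply: feasible_marginal.
move=> _ [x xP <-].
have [|z' z'F z'x] := @feasible_coef x; first by move=> i; apply: xP.
by have := zmax z' z'F; rewrite /value z'x.
Qed.

Lemma common_indep_maximum :
  exists opt, is_maximum (common_indep_weights M w) opt.
Proof.
have P0 : [forall i, indep (M i) finset.set0] by apply/forallP => i; apply: indep0.
case: (@arg_maxP _ _ _ _ (fun I : {set E} => [forall i, indep (M i) I])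
  (fun I => \sum_(e in I) w e) P0) => I /forallP iI Imax.
exists (\sum_(e in I) w e); split; first by exists I.
by move=> _ [J iJ <-]; apply: Imax; apply/forallP.
Qed.

End LpMaximum.

Theorem theorem1p1 (R : realType) (k : nat) (hk : (2 <= k)%N) (E : finType)
    (M : 'I_k -> matroid E) (w : E -> R) :
  exists lp opt : R,
    [/\ is_maximum (lp_values M w) lp,
        is_maximum (common_indep_weights M w) opt &
        lp <= (k%:R - 1 + k%:R^-1) * opt].
Proof.
pose i0 : 'I_k := Ordinal (ltnW hk).
have [lp lpM] := lp_maximum_attained M w i0.
have [opt optM] := common_indep_maximum M w.
exists lp, opt; split=> //; have [[x xP <-] _] := lpM.
have [I [iI leI]] := lp_gap w i0 (fun i => indep_polytope_rank (xP i I)).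
apply: le_trans leI _; apply: ler_wpM2l; last by apply: optM.2; exists I.
by rewrite addr_ge0 ?invr_ge0 // subr_ge0 ler1n ltnW.
Qed.
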